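(* $\mathbb{R}^2$ is the only closed circle-center set; that is, $\mathbb{R}^2$ is a closed circle-center set, and if $S\subset\mathbb{R}^2$ is a circle-center set that is closed in $\mathbb{R}^2$, then $S=\mathbb{R}^2$.
   Context: A set $S\subset\mathbb{R}^2$ is said to contain its circle centers if, for any three non-collinear points of $S$, the center of the circle through those three points (their circumcenter) is also in $S$. A circle-center set is a subset of $\mathbb{R}^2$ that is not a subset of any line and that contains its circle centers. *)

(* Defs.v *)
(* The plane is R * R for an arbitrary realType R; its product topology is the
   Euclidean one. *)
From mathcomp Require Import all_boot all_order all_algebra.
From mathcomp Require Import ring lra.
From mathcomp Require Import all_classical all_reals all_analysis.

Set Implicit Arguments.
Unset Strict Implicit.
Unset Printing Implicit Defensive.

Import Order.TTheory GRing.Theory Num.Theory.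
Import numFieldNormedType.Exports.

Local Open Scope classical_set_scope.
Local Open Scope ring_scope.

(* The norm that the library puts on R * R is the sup norm, so the Euclidean
   distance is spelled out. *)
Definition eucl_dist {R : realType} (p q : R * R) : R :=
  Num.sqrt ((p.1 - q.1) ^+ 2 + (p.2 - q.2) ^+ 2).

Definition circle {R : realType} (c : R * R) (rho : R) : set (R * R) :=
  [set p | eucl_dist p c = rho].

Definition is_line {R : realType} (L : set (R * R)) : Prop :=
  exists a b c : R,
    (a, b) <> (0, 0) /\ L = [set p | a * p.1 + b * p.2 = c].

Definition collinear {R : realType} (p q r : R * R) : Prop :=
  exists L : set (R * R), [/\ is_line L, L p, L q & L r].

Definition is_circumcenter {R : realType} (p q r c : R * R) : Prop :=
  exists2 rho : R, 0 < rho &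
    [/\ circle c rho p, circle c rho q & circle c rho r].

(* The universal quantifier over c stands for "the circumcenter": it ranges
   over exactly one point, by circumcenter_exists_unique. *)
Definition contains_circle_centers {R : realType} (S : set (R * R)) : Prop :=
  forall p q r : R * R, S p -> S q -> S r -> ~ collinear p q r ->
  forall c : R * R, is_circumcenter p q r c -> S c.

Definition circle_center_set {R : realType} (S : set (R * R)) : Prop :=
  ~ (exists2 L : set (R * R), is_line L & S `<=` L) /\
  contains_circle_centers S.

Lemma circumcenter_exists_unique (R : realType) (p q r : R * R) :
  ~ collinear p q r -> exists! c : R * R, is_circumcenter p q r c.
Proof.
move: p q r => [p1 p2] [q1 q2] [r1 r2] ncol.
have line_of (a b : R) : (a, b) <> (0, 0) ->
    a * q1 + b * q2 = a * p1 + b * p2 -> a * r1 + b * r2 = a * p1 + b * p2 ->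
    False.
  move=> ab0 eq er; apply: ncol.
  exists [set x | a * x.1 + b * x.2 = a * p1 + b * p2]; split => //.
  by exists a, b, (a * p1 + b * p2).
pose u1 := q1 - p1; pose u2 := q2 - p2; pose v1 := r1 - p1; pose v2 := r2 - p2.
have det0 : u1 * v2 - u2 * v1 != 0.
  apply/eqP => det0.
  have [u0|u0] := pselect ((- u2, u1) = (0, 0)); last first.
    by apply: (line_of _ _ u0); rewrite /u1 /u2 /v1 /v2 in det0 *; lra.
  have [v0|v0] := pselect ((- v2, v1) = (0, 0)); last first.
    by apply: (line_of _ _ v0); rewrite /u1 /u2 /v1 /v2 in det0 *; lra.
  case: u0 => u20 u10; case: v0 => v20 v10.
  apply: (line_of 1 0); first by move=> [] /eqP; rewrite oner_eq0.
  - by rewrite /u1 in u10; lra.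
  - by rewrite /v1 in v10; lra.
pose sq (a b c1 c2 : R) := (a - c1) ^+ 2 + (b - c2) ^+ 2.
have sq_ge0 a b c1 c2 : 0 <= sq a b c1 c2 by rewrite addr_ge0 ?sqr_ge0.
pose U := (u1 ^+ 2 + u2 ^+ 2) / 2; pose V := (v1 ^+ 2 + v2 ^+ 2) / 2.
pose D := u1 * v2 - u2 * v1.
pose x := (U * v2 - V * u2) / D; pose y := (V * u1 - U * v1) / D.
have ex : u1 * x + u2 * y = U by rewrite /x /y /D; field.
have ey : v1 * x + v2 * y = V by rewrite /x /y /D; field.
exists (p1 + x, p2 + y); split.
  have eq : sq q1 q2 (p1 + x) (p2 + y) = sq p1 p2 (p1 + x) (p2 + y).
    by move: ex; rewrite /sq /U /u1 /u2 !expr2 => ?; lra.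
  have er : sq r1 r2 (p1 + x) (p2 + y) = sq p1 p2 (p1 + x) (p2 + y).
    by move: ey; rewrite /sq /V /v1 /v2 !expr2 => ?; lra.
  exists (Num.sqrt (sq p1 p2 (p1 + x) (p2 + y))); last first.
    split; rewrite /circle /eucl_dist /= -/(sq _ _ _ _) //.
    - by rewrite -eq.
    - by rewrite -er.
  rewrite sqrtr_gt0 lt_def sq_ge0 andbT; apply/eqP => e0.
  have sq0 a b : sq a b (p1 + x) (p2 + y) = 0 -> a = p1 + x /\ b = p2 + y.
    move/eqP; rewrite paddr_eq0 ?sqr_ge0 // !sqrf_eq0 !subr_eq0.
    by case/andP => /eqP -> /eqP ->.
  case: (sq0 _ _ e0) => a1 a2.
  case: (sq0 q1 q2); first by rewrite eq.
  move=> b1 b2; move/eqP: det0; apply.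
  by rewrite /u1 /u2 b1 b2 -a1 -a2 !subrr !mul0r subrr.
move=> [c1 c2] [rho _ []]; rewrite /circle /eucl_dist /=.
rewrite -!/(sq _ _ _ _) => ep eq er.
have eqp : sq q1 q2 c1 c2 = sq p1 p2 c1 c2.
  by apply/eqP; rewrite -eqr_sqrt // eq ep.
have erp : sq r1 r2 c1 c2 = sq p1 p2 c1 c2.
  by apply/eqP; rewrite -eqr_sqrt // er ep.
have fx : u1 * (c1 - p1) + u2 * (c2 - p2) = U.
  by move: eqp; rewrite /sq /U /u1 /u2 !expr2 => ?; lra.
have fy : v1 * (c1 - p1) + v2 * (c2 - p2) = V.
  by move: erp; rewrite /sq /V /v1 /v2 !expr2 => ?; lra.
by congr pair; rewrite /x /y /D -fx -fy; field.
Qed.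

(* Main.v *)
Require Import Defs.
From mathcomp Require Import all_boot all_order all_algebra.
From mathcomp Require Import ring lra.
From mathcomp Require Import all_classical all_reals all_analysis.
Import Order.TTheory GRing.Theory Num.Theory.
Import numFieldNormedType.Exports.
Local Open Scope classical_set_scope.
Local Open Scope ring_scope.

(** The plane is identified with the complex numbers.  Let S be a closed
    circle-center set.  Three noncollinear points and their circumcenter give an
    isosceles triangle in S ([exists_isosceles]).  The proof then has three
    ideas.

    A contracting spiral.  Replacing the apex P of an isosceles triangle A, B, P
    by its circumcenter O doubles an angle of the triangle, so after some steps
    the shape is far from degenerate ([exists_contracting]).  For such a shape,
    the circumcenter of A, O, P completes the side AO to a smaller isosceles
    triangle similar to the first, with A at the same place
    ([isosceles_spiral]).  Hence the point A of S is an accumulation point of S.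

    Limit circles.  By compactness, points of S approach A along some direction
    ([limit_direction]).  Since S is closed, it contains the centers of the
    circles through another point of S that are tangent to this direction at A
    ([normal_center]).  These centers lie on the normal at A; if the other point
    is itself on the normal at signed height z, the center is at z / 2.  So S
    also accumulates at A along the normal, and the same holds with the two
    directions exchanged ([bitangent_of_tangent]).  Taking A as the origin and
    the two directions as axes, S contains points of both axes, and with each
    its successive halves.

    Small steps.  From (x, 0) and (0, y) one gets the midpoint (x / 2, y / 2) and
    then the center (0, y / 4 + x ^ 2 / (4 y)) of a limit circle.  A passage to
    the limit shows that heights can be doubled too ([bitangent_double_y]), so
    y can be replaced by y + x ^ 2 / y.  As x can be taken arbitrarily small, S
    contains a half axis ([bitangent_half_axis]).  Circles through two points of
    the half axis and one point (x, 0) then have their centers all over a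
    quadrant ([bitangent_quadrant]), and every point of the plane is the center
    of a circle with three points in that quadrant ([setT_of_quadrant]). *)

(** * Circumcenters in algebraic form *)

Definition sqdist {R : realType} (p q : R * R) : R :=
  (p.1 - q.1) ^+ 2 + (p.2 - q.2) ^+ 2.

Definition area2 {R : realType} (p q r : R * R) : R :=
  (q.1 - p.1) * (r.2 - p.2) - (q.2 - p.2) * (r.1 - p.1).

(** The working form of the closure hypothesis.  No radius appears: it is
    positive automatically, because three points at distance 0 from c would
    coincide and span no area. *)
Definition center_closed {R : realType} (S : set (R * R)) : Prop :=
  forall p q r c : R * R, S p -> S q -> S r -> area2 p q r != 0 ->
  sqdist p c = sqdist q c -> sqdist p c = sqdist r c -> S c.

Lemma area2_noncollinear (R : realType) (p q r : R * R) :
  area2 p q r != 0 -> ~ collinear p q r.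
Proof.
move=> /eqP d0 [_ [[a [b [c [ab0 ->]]]]]] /= hp hq hr.
have ha : a * area2 p q r = 0.
  rewrite /area2.
  have -> : a * ((q.1 - p.1) * (r.2 - p.2) - (q.2 - p.2) * (r.1 - p.1)) =
    (a * q.1 + b * q.2 - (a * p.1 + b * p.2)) * (r.2 - p.2)
    - (q.2 - p.2) * (a * r.1 + b * r.2 - (a * p.1 + b * p.2)) by ring.
  by rewrite hp hq hr; ring.
have hb : b * area2 p q r = 0.
  rewrite /area2.
  have -> : b * ((q.1 - p.1) * (r.2 - p.2) - (q.2 - p.2) * (r.1 - p.1)) =
    (a * r.1 + b * r.2 - (a * p.1 + b * p.2)) * (q.1 - p.1)
    - (r.1 - p.1) * (a * q.1 + b * q.2 - (a * p.1 + b * p.2)) by ring.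
  by rewrite hp hq hr; ring.
apply: ab0; congr pair.
  by move/eqP: ha; rewrite mulf_eq0 => /orP[/eqP//|/eqP].
by move/eqP: hb; rewrite mulf_eq0 => /orP[/eqP//|/eqP].
Qed.

Lemma circle_centers_center_closed (R : realType) (S : set (R * R)) :
  contains_circle_centers S -> center_closed S.
Proof.
move=> H p q r c Sp Sq Sr d0 epq epr.
apply: (H p q r Sp Sq Sr (area2_noncollinear _ _ _ _ d0)).
exists (Num.sqrt (sqdist p c)); last first.
  by rewrite /circle /eucl_dist /= -!/(sqdist _ _) -epr -epq.
rewrite sqrtr_gt0 lt_def addr_ge0 ?sqr_ge0 // andbT.
apply: contra_neq d0 => e0.
have eq_c (a : R * R) : sqdist a c = 0 -> a = c.
  rewrite /sqdist => /eqP; rewrite paddr_eq0 ?sqr_ge0 // !sqrf_eq0 !subr_eq0.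
  by case/andP=> /eqP h1 /eqP h2; rewrite [a]surjective_pairing h1 h2 -surjective_pairing.
have pc : p = c by apply: eq_c.
have qc : q = c by apply: eq_c; rewrite -epq.
by rewrite /area2 pc qc !subrr !mul0r subrr.
Qed.

Lemma noncollinear_triple (R : realType) (S : set (R * R)) :
  ~ (exists2 L : set (R * R), is_line L & S `<=` L) ->
  exists p q r, [/\ S p, S q, S r & area2 p q r != 0].
Proof.
move=> nl.
have off (a b c : R) : (a, b) <> (0, 0) ->
    exists p, S p /\ a * p.1 + b * p.2 != c.
  move=> ab; apply: contrapT => h; apply: nl.
  exists [set p | a * p.1 + b * p.2 = c]; first by exists a, b, c.
  move=> p Sp /=; apply/eqP/negPn/negP => ne; apply: h; by exists p.
have e10 : (1 : R, 0 : R) <> (0, 0) by case=> /eqP; rewrite oner_eq0.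
have [p [Sp _]] := off 1 0 0 e10.
have [q [Sq qp]] : exists q, S q /\ q <> p.
  apply: contrapT => h.
  have [q [Sq /negP]] := off 1 0 p.1 e10; apply; apply/eqP.
  have -> : q = p by apply: contrapT => ne; apply: h; exists q.
  by ring.
have pq0 : (p.2 - q.2, q.1 - p.1) <> (0, 0).
  case=> h2 h1; apply: qp.
  by rewrite [q]surjective_pairing [p]surjective_pairing; congr pair; lra.
have [r [Sr hr]] := off _ _ ((p.2 - q.2) * p.1 + (q.1 - p.1) * p.2) pq0.
exists p, q, r; split => //; apply: contra_neq hr; rewrite /area2 => h.
by apply/eqP; rewrite -subr_eq0 -h; apply/eqP; ring.
Qed.

(** * Changing coordinates *)

(** Reading the plane as the complex numbers, this is p |-> o + v p: the point
    whose coordinates are p in the frame with origin o and first basis vector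
    v.  Each such map with v != 0 is a similarity, so it preserves every
    hypothesis on the set and all configurations can be put in standard
    position. *)
Definition frame {R : realType} (o v p : R * R) : R * R :=
  (o.1 + p.1 * v.1 - p.2 * v.2, o.2 + p.1 * v.2 + p.2 * v.1).

Lemma pair_neq0l (R : realType) (x y : R) : x != 0 -> (x, y) != 0.
Proof. by move=> x0; apply: contra_neq x0 => -[]. Qed.

Lemma pair_neq0r (R : realType) (x y : R) : y != 0 -> (x, y) != 0.
Proof. by move=> y0; apply: contra_neq y0 => -[]. Qed.

Lemma sqnorm_gt0 (R : realType) (v : R * R) :
  v != 0 -> 0 < v.1 ^+ 2 + v.2 ^+ 2.
Proof.
move=> v0; rewrite lt_def addr_ge0 ?sqr_ge0 // andbT.
apply: contra v0; rewrite paddr_eq0 ?sqr_ge0 // !sqrf_eq0 => /andP[/eqP h1 /eqP h2].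
by rewrite [v]surjective_pairing h1 h2.
Qed.

Lemma center_closed_frame (R : realType) (S : set (R * R)) (o v : R * R) :
  v != 0 -> center_closed S -> center_closed (frame o v @^-1` S).
Proof.
move=> /sqnorm_gt0/lt0r_neq0 v0 H p q r c Sp Sq Sr d0 epq epr.
have sq a b : sqdist (frame o v a) (frame o v b) =
    (v.1 ^+ 2 + v.2 ^+ 2) * sqdist a b by rewrite /sqdist /frame /=; ring.
apply: (H _ _ _ _ Sp Sq Sr); rewrite ?sq; [|by rewrite epq|by rewrite epr].
have -> : area2 (frame o v p) (frame o v q) (frame o v r) =
    (v.1 ^+ 2 + v.2 ^+ 2) * area2 p q r by rewrite /area2 /frame /=; ring.
by rewrite mulf_neq0.
Qed.

Lemma closed_frame (R : realType) (S : set (R * R)) (o v : R * R) :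
  closed S -> closed (frame o v @^-1` S).
Proof.
apply: closed_comp => p _.
have cf : {for p, continuous (@fst R R)} by exact: cvg_fst.
have cs : {for p, continuous (@snd R R)} by exact: cvg_snd.
have cc (a : R) : {for p, continuous (fun _ : R * R => a)} by exact: cvg_cst.
have h1 : {for p, continuous (fun p : R * R => o.1 + p.1 * v.1 - p.2 * v.2)}.
  apply: continuousB; last exact: continuousM.
  by apply: continuousD => //; exact: continuousM.
have h2 : {for p, continuous (fun p : R * R => o.2 + p.1 * v.2 + p.2 * v.1)}.
  apply: continuousD; last exact: continuousM.
  by apply: continuousD => //; exact: continuousM.
exact: (cvg_pair h1 h2).
Qed.

(** Complex multiplication, which composes the linear parts of frames. *)
Definition cmul {R : realType} (v w : R * R) : R * R :=
  (v.1 * w.1 - v.2 * w.2, v.1 * w.2 + v.2 * w.1).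

Lemma frame_comp (R : realType) (o v o' v' p : R * R) :
  frame o v (frame o' v' p) = frame (frame o v o') (cmul v v') p.
Proof. by rewrite /frame /cmul /=; congr pair; ring. Qed.

Lemma preimage_frame_setT (R : realType) (S : set (R * R)) (o v : R * R) :
  v != 0 -> frame o v @^-1` S = setT -> S = setT.
Proof.
move=> /sqnorm_gt0/lt0r_neq0 v0 fS; apply/seteqP; split=> // p _.
pose n := v.1 ^+ 2 + v.2 ^+ 2.
pose q := (((p.1 - o.1) * v.1 + (p.2 - o.2) * v.2) / n,
           ((p.2 - o.2) * v.1 - (p.1 - o.1) * v.2) / n).
have : (frame o v @^-1` S) q by rewrite fS.
rewrite /preimage /=; suff -> : frame o v q = p by [].
rewrite [RHS]surjective_pairing /frame /q /n /=.
by congr pair; field.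
Qed.

(** * Approximation *)

Lemma closed_approx (R : realType) (S : set (R * R)) (l : R * R) :
  closed S ->
  (forall e, 0 < e -> exists2 p, S p & `|p.1 - l.1| < e /\ `|p.2 - l.2| < e) ->
  S l.
Proof.
move=> cS h; apply: cS => B /nbhs_ballP [e /= e0 eB].
have [p Sp [h1 h2]] := h e e0.
by exists p; split => //; apply: eB; split; rewrite /ball /= distrC.
Qed.

Lemma expr_small (R : realType) (x e : R) :
  0 <= x < 1 -> 0 < e -> exists n, x ^+ n < e.
Proof.
move=> /andP[x0 x1] e0.
have /cvgr0Pnorm_lt/(_ e e0) : (GRing.exp x : nat -> R) @ \oo --> (0 : R).
  by apply: cvg_expr; rewrite ger0_norm.
case=> N _ /(_ N (leqnn N)) /=.
by rewrite ger0_norm ?exprn_ge0 // => h; exists N.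
Qed.

Lemma inv_succ_lt (R : realType) (e : R) :
  0 < e -> exists N, forall n, (N <= n)%N -> (n.+1%:R : R)^-1 < e.
Proof.
move=> e0; have [N _ hN] := near_infty_natSinv_lt (PosNum e0).
by exists N => n Nn; apply: hN.
Qed.

(** * An isosceles triangle spiralling into a vertex *)

(** The parameter y is the slope of the left leg, that is the tangent of the
    base angle: it depends on the shape of the triangle only.  A negative y puts
    the apex below the base. *)
Definition isosceles {R : realType} (S : set (R * R)) (y : R) : Prop :=
  [/\ S (0, 0), S (1, 0) & S (1 / 2, y / 2)].

(** The circumcenter is equidistant from any two of the vertices.  It can serve
    as apex over the base from (0, 0) to (1, 0) unless it is the midpoint of
    that side; in this case the side is the hypotenuse of a right triangle, and
    the circumcenter lies off the side from (0, 0) to (x, y), which becomes the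
    base. *)
Lemma isosceles_of_base (R : realType) (S : set (R * R)) (x y : R) :
  center_closed S -> S (0, 0) -> S (1, 0) -> S (x, y) -> y != 0 ->
  exists v h, [/\ v != 0, h != 0 & isosceles (frame (0, 0) v @^-1` S) h].
Proof.
move=> cS S0 S1 Sp y0.
have Sc : S (1 / 2, (x ^+ 2 + y ^+ 2 - x) / (2 * y)).
  apply: (cS _ _ _ _ S0 S1 Sp); rewrite /area2 /sqdist /=; [|by field..].
  by rewrite !subr0 mul1r mul0r subr0.
have [e|ne] := eqVneq (x ^+ 2 + y ^+ 2 - x) 0; last first.
  (* The circumcenter is off the base: the frame need not change. *)
  exists (1, 0), ((x ^+ 2 + y ^+ 2 - x) / y).
  split; [by rewrite pair_neq0l ?oner_eq0|by rewrite mulf_neq0 ?invr_eq0|].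
  split; rewrite /frame /preimage /=
    ?(mul0r, mul1r, mulr0, mulr1, oppr0, subr0, addr0, add0r) //.
  have <- : (x ^+ 2 + y ^+ 2 - x) / (2 * y) = (x ^+ 2 + y ^+ 2 - x) / y / 2.
    by field.
  by rewrite -div1r.
have x0 : x != 0.
  apply: contra_neq y0 => x0; rewrite x0 in e.
  by apply/eqP; rewrite -sqrf_eq0; apply/eqP; lra.
(* Right angle at (x, y): divide the midpoint 1 / 2 by x + i y, where
   x ^ 2 + y ^ 2 = x; the quotient is 1 / 2 - i y / (2 x). *)
exists (x, y), (- y / x).
split; [exact: pair_neq0l|by rewrite mulf_neq0 ?invr_eq0 ?oppr_eq0|].
split; rewrite /frame /preimage /= ?(mul0r, mul1r, oppr0, subr0, addr0, add0r) //.
rewrite e mul0r in Sc.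
suff -> : (2^-1 * x - - y / x / 2 * y, 2^-1 * y + - y / x / 2 * x) =
          (1 / 2, 0 : R) by [].
have e' : y ^+ 2 = x - x ^+ 2 by lra.
congr pair; last by field.
have -> : 2^-1 * x - - y / x / 2 * y = (x ^+ 2 + y ^+ 2) / (2 * x) by field.
by rewrite e'; field.
Qed.

Lemma exists_isosceles (R : realType) (S : set (R * R)) (p q r : R * R) :
  center_closed S -> S p -> S q -> S r -> area2 p q r != 0 ->
  exists o v h, [/\ v != 0, h != 0 & isosceles (frame o v @^-1` S) h].
Proof.
move=> cS Sp Sq Sr d0; pose v := (q.1 - p.1, q.2 - p.2).
have v0 : v != 0.
  by apply: contra_neq d0; rewrite /area2 => -[-> ->]; rewrite !mul0r subrr.
have n0 := lt0r_neq0 (sqnorm_gt0 _ _ v0).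
pose n := v.1 ^+ 2 + v.2 ^+ 2.
pose x := ((r.1 - p.1) * v.1 + (r.2 - p.2) * v.2) / n.
pose y := area2 p q r / n.
have [] := @isosceles_of_base R (frame p v @^-1` S) x y.
- exact: center_closed_frame.
- by rewrite /preimage /frame /= !mul0r subr0 !addr0 -surjective_pairing.
- rewrite /preimage /frame /= !mul0r !mul1r subr0 addr0.
  by rewrite addrC subrK [_ + (_ - _)]addrC subrK -surjective_pairing.
- rewrite /preimage /=; suff -> : frame p v (x, y) = r by [].
  rewrite [RHS]surjective_pairing /frame /x /y /area2 /n /= in n0 *.
  by congr pair; field.
- by rewrite mulf_neq0 ?invr_eq0.
move=> w [h [w0 h0 iso]]; exists p, (cmul v w), h; split => //.
  have := mulf_neq0 n0 (lt0r_neq0 (sqnorm_gt0 _ _ w0)).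
  apply: contra_neq => -[e1 e2].
  transitivity ((v.1 * w.1 - v.2 * w.2) ^+ 2 + (v.1 * w.2 + v.2 * w.1) ^+ 2).
    by ring.
  by rewrite e1 e2; ring.
have e u : frame p (cmul v w) u = frame p v (frame (0, 0) w u).
  rewrite frame_comp; congr frame.
  by rewrite /frame /= !mul0r subr0 !addr0 -surjective_pairing.
by case: iso; rewrite /preimage /= => *; split; rewrite /preimage /= e.
Qed.

(** The parameter of the triangle on the same base whose apex is the old
    circumcenter.  With y = cot a it equals cot (2 a), by the double-angle
    formula. *)
Definition center_ordinate {R : realType} (y : R) : R := (y ^+ 2 - 1) / (2 * y).

Lemma isosceles_doubling (R : realType) (S : set (R * R)) (y : R) :
  center_closed S -> y != 0 -> isosceles S y -> isosceles S (center_ordinate y).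
Proof.
move=> cS y0 [S0 S1 Sy]; split => //.
apply: (cS _ _ _ _ S0 S1 Sy); rewrite /area2 /sqdist /center_ordinate /=; [|by field..].
by rewrite !subr0 mul1r mul0r subr0 mulf_neq0 ?invr_eq0.
Qed.

(** Replacing the apex by the circumcenter doubles the angle a of
    [center_ordinate], and doubling eventually drives any angle that is not a
    multiple of pi out of the arcs where |cot| >= sqrt 3.  Concretely, as long as
    k = center_ordinate y has k ^ 2 >= 3, the next value (k ^ 2 - 1) / (2 k) has
    absolute value at most |k| / 2, so the condition fails after finitely many
    steps; k is nonzero meanwhile, so the triangles stay nondegenerate. *)
Lemma exists_contracting (R : realType) (S : set (R * R)) (y : R) :
  center_closed S -> y != 0 -> isosceles S y ->
  exists h, [/\ h != 0, isosceles S h & center_ordinate h ^+ 2 < 3].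
Proof.
move=> cS; have [n] : exists n, center_ordinate y ^+ 2 / 3 * (1 / 4) ^+ n < 1.
  pose c := center_ordinate y ^+ 2 / 3.
  have c0 : 0 <= c by rewrite divr_ge0 ?sqr_ge0.
  have [n hn] := @expr_small R (1 / 4) (c + 1)^-1 ltac:(lra) ltac:(rewrite invr_gt0; lra).
  exists n; rewrite -/c.
  apply: le_lt_trans (_ : (c + 1) * (1 / 4) ^+ n < 1).
    by rewrite ler_wpM2r ?exprn_ge0 //; lra.
  by rewrite mulrC -ltr_pdivlMr ?[1 / (c + 1)]div1r //; lra.
elim: n y => [|n IHn] y hn y0 iso.
  by exists y; split => //; rewrite expr0 mulr1 ltr_pdivrMr // mul1r in hn.
have [small|big] := ltP (center_ordinate y ^+ 2) 3; first by exists y.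
set k := center_ordinate y in big hn *.
have k0 : k != 0 by apply: contraTneq big => ->; rewrite expr0n -ltNge.
apply: (IHn k) => //; last exact: isosceles_doubling.
have kk : center_ordinate k ^+ 2 <= k ^+ 2 / 4.
  have -> : center_ordinate k ^+ 2 = k ^+ 2 / 4 - (2 * k ^+ 2 - 1) / (4 * k ^+ 2).
    by rewrite /center_ordinate; field.
  by rewrite lerBlDr lerDl divr_ge0 //; lra.
apply: le_lt_trans hn; rewrite [_ ^+ n.+1]exprS mulrA.
by rewrite ler_wpM2r ?exprn_ge0 //; lra.
Qed.

(** Let A = (0, 0), P the apex and O the circumcenter, and put
    k = center_ordinate y.  Then OA = OP, and the circumcenter O' of A, P, O is
    the apex of an isosceles triangle on the base AO similar to the first one:
    the multiplication by O = (1 + i k) / 2 maps the triangle onto it.  This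
    similarity fixes A, so iterating it brings vertices to A at the geometric
    rate |O|, and |O| ^ 2 = (1 + k ^ 2) / 4 is below 1 exactly when
    k ^ 2 < 3. *)
Lemma isosceles_spiral (R : realType) (S : set (R * R)) (y : R) (n : nat) :
  center_closed S -> y != 0 -> isosceles S y ->
  exists2 z, S z &
    z.1 ^+ 2 + z.2 ^+ 2 = ((1 + center_ordinate y ^+ 2) / 4) ^+ n.
Proof.
move=> + y0; elim: n S => [|n IHn] S cS iso.
  by case: iso => S0 S1 _; exists (1, 0) => //=; rewrite expr0; ring.
set k := center_ordinate y.
have [S0 S1 Sy] := iso; have [_ _ Sk] := isosceles_doubling _ _ _ cS y0 iso.
rewrite -/k in Sk.
have Sk' : S ((1 - k * y) / 4, (k + y) / 4).
  apply: (cS _ _ _ _ S0 Sy Sk); rewrite /area2 /sqdist /=; last 2 first.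
  - by rewrite /k /center_ordinate; field.
  - by field.
  have -> : (1 / 2 - 0) * (k / 2 - 0) - (y / 2 - 0) * (1 / 2 - 0) =
            - (y ^+ 2 + 1) / (8 * y) by rewrite /k /center_ordinate; field.
  rewrite mulf_neq0 ?invr_eq0 ?mulf_neq0 // oppr_eq0 gt_eqF //.
  by rewrite ltr_wpDl ?sqr_ge0.
have w0 : (1 / 2, k / 2) != 0 :> R * R by rewrite pair_neq0l.
have [||z Sz ez] := IHn (frame (0, 0) (1 / 2, k / 2) @^-1` S).
- exact: center_closed_frame.
- split; rewrite /preimage /frame /= ?(mul0r, mul1r, oppr0, subr0, add0r, addr0) //.
    by rewrite div1r in Sk.
  by rewrite (_ : (_, _) = ((1 - k * y) / 4, (k + y) / 4)) //; congr pair; field.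
exists (frame (0, 0) (1 / 2, k / 2) z) => //.
by rewrite [_ ^+ n.+1]exprS -ez /frame /=; field.
Qed.

(** * A tangent direction at an accumulation point *)

Definition tangent_to_x_axis {R : realType} (S : set (R * R)) : Prop :=
  forall e : R, 0 < e ->
  exists a t, [/\ a != 0, `|a| < e, `|t| < e & S (a, a * t)].

Lemma compact_unit_circle (R : realType) :
  compact [set d : R * R | d.1 ^+ 2 + d.2 ^+ 2 = 1].
Proof.
have box := compact_setX (@segment_compact R (-1) 1) (@segment_compact R (-1) 1).
apply: (subclosed_compact _ box).
  have -> : [set d : R * R | d.1 ^+ 2 + d.2 ^+ 2 = 1] =
      (fun d : R * R => d.1 * d.1 + d.2 * d.2) @^-1` [set 1].
    by apply/seteqP; split=> d; rewrite /= !expr2.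
  apply: closed_comp; last exact: closed_eq.
  move=> d _; have c1 : {for d, continuous (@fst R R)} by exact: cvg_fst.
  have c2 : {for d, continuous (@snd R R)} by exact: cvg_snd.
  have c : {for d, continuous (fun d : R * R => d.1 * d.1 + d.2 * d.2)}.
    by apply: continuousD; exact: continuousM.
  exact: c.
have sqr_le1 (x y : R) : x ^+ 2 + y ^+ 2 = 1 -> -1 <= x <= 1.
  move=> h; rewrite -ler_norml -(@ler_pXn2r _ 2) ?nnegrE // expr1n real_normK ?num_real //.
  by rewrite -h lerDl sqr_ge0.
move=> [d1 d2] /= h; split; rewrite /= in_itv /=; first exact: sqr_le1 h.
by apply: (@sqr_le1 _ d1); rewrite addrC.
Qed.

(** The directions of points of S tending to the origin have a cluster point u
    on the unit circle; u becomes the first axis of the frame. *)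
Lemma limit_direction (R : realType) (S : set (R * R)) :
  (forall e, 0 < e -> exists2 z, S z & 0 < z.1 ^+ 2 + z.2 ^+ 2 < e) ->
  exists2 u, u != 0 & tangent_to_x_axis (frame (0, 0) u @^-1` S).
Proof.
move=> acc.
have /choice[f hf] (n : nat) : exists sd : R * (R * R),
    [/\ 0 < sd.1 < n.+1%:R^-1, sd.2.1 ^+ 2 + sd.2.2 ^+ 2 = 1 &
        S (sd.1 * sd.2.1, sd.1 * sd.2.2)].
  have [|z Sz /andP[z0 zn]] := acc (n.+1%:R^-1 ^+ 2); first by rewrite exprn_gt0.
  set m := z.1 ^+ 2 + z.2 ^+ 2 in z0 zn.
  have s0 : 0 < Num.sqrt m by rewrite sqrtr_gt0.
  have sm : Num.sqrt m ^+ 2 = m by rewrite sqr_sqrtr // ltW.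
  exists (Num.sqrt m, (z.1 / Num.sqrt m, z.2 / Num.sqrt m)); split=> /=.
  - by rewrite s0 -(@ltr_pXn2r _ 2) ?nnegrE ?invr_ge0 ?ltW // sm.
  - by rewrite !exprMn exprVn sm -mulrDl divff // gt_eqF.
  - by rewrite ![Num.sqrt m * _]mulrC !divfK ?gt_eqF // -surjective_pairing.
have [|u [/= u1 clu]] :=
    @compact_unit_circle R ((fun n => (f n).2) @ \oo) _ _.
  by exists 0%N => // n _ /=; case: (hf n).
exists u.
  apply: contra_eq_neq u1 => ->; rewrite /= expr0n addr0; apply/eqP.
  by move/eqP; rewrite eq_sym oner_eq0.
(* In the frame of u the point s d is s (al + i be), where al and be are the
   cosine and the sine of the angle from u to d.  With |d - u| small, al is
   close to 1 and be to 0, so a = s al and t = be / al will do.  The bound 1 / 8 on r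
   makes al > 1 / 2. *)
move=> e e0; pose r := Num.min (e / 8) (1 / 8).
have r0 : 0 < r by rewrite lt_min; lra.
have [re r1] : r <= e / 8 /\ r <= 1 / 8 by rewrite !ge_min !lexx orbT.
have [N hN] := inv_succ_lt R r r0.
have [d [[n Nn dn] du]] : [set (f n).2 | n in [set n | (N <= n)%N]] `&` ball u r !=set0.
  apply: clu; last exact: nbhsx_ballx.
  by exists N => // n /= Nn; exists n.
have [/andP[s0 sn] d1 Sd] := hf n.
rewrite dn in d1 Sd.
have {hN Nn}sr := lt_trans sn (hN n Nn).
set s := (f n).1 in s0 sn Sd sr.
case: du; rewrite /ball /= !ltr_norml => /andP[x1 x2] /andP[y1 y2].
pose al := d.1 * u.1 + d.2 * u.2; pose be := u.1 * d.2 - u.2 * d.1.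
have sq_lt (x : R) : - r < x -> x < r -> x ^+ 2 < r ^+ 2.
  move=> h1 h2; rewrite -subr_gt0 subr_sqr mulr_gt0 //; lra.
have al1 : 1 - al < r ^+ 2.
  have -> : 1 - al = ((u.1 - d.1) ^+ 2 + (u.2 - d.2) ^+ 2) / 2.
    have -> : 1 - al = ((u.1 ^+ 2 + u.2 ^+ 2) + (d.1 ^+ 2 + d.2 ^+ 2)) / 2 - al.
      by rewrite u1 d1; field.
    by rewrite /al; field.
  by have := sq_lt _ x1 x2; have := sq_lt _ y1 y2; lra.
have albe : al ^+ 2 + be ^+ 2 = 1.
  rewrite -[RHS]mulr1 -{1}u1 -d1 /al /be; ring.
have rr : r ^+ 2 <= 1 / 64.
  by nra.
have be0 := sqr_ge0 be.
have al2 : al <= 1 by rewrite -ler_sqr ?nnegrE //; lra.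
have be2 : `|be| < 2 * r.
  rewrite -ltr_sqr ?nnegrE //; last by lra.
  rewrite real_normK ?num_real //.
  have -> : be ^+ 2 = (1 - al) * (1 + al) by rewrite -[LHS](addKr (al ^+ 2)) albe; ring.
  apply: le_lt_trans (_ : (1 - al) * 2 < _); first by rewrite ler_wpM2l; lra.
  have r2 : 0 < r ^+ 2 by rewrite exprn_gt0.
  by rewrite exprMn; lra.
have al0 : 0 < al by lra.
exists (s * al), (be / al); split.
- by rewrite mulf_neq0 ?gt_eqF.
- rewrite ger0_norm ?mulr_ge0 1?ltW //.
  by apply: le_lt_trans (_ : s * 1 < e); rewrite ?ler_wpM2l; lra.
- rewrite normrM normfV (ger0_norm (ltW al0)) ltr_pdivrMr //.
  apply: lt_le_trans be2 _; apply: le_trans (_ : e / 2 * (1 / 2) <= _); first lra.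
  by rewrite ler_pM; lra.
- suff -> : frame (0, 0) u (s * al, s * al * (be / al)) = (s * d.1, s * d.2) by [].
  have -> : s * al * (be / al) = s * be by field; rewrite gt_eqF.
  rewrite -[s * d.1]mulr1 -[s * d.2]mulr1 -u1 /frame /al /be /=.
  by congr pair; ring.
Qed.

(** * Axes from a tangent direction *)

(** A circle through the origin and (x, y) that also passes through points of S
    tending to the origin along the x-axis tends to the circle tangent to the
    x-axis at the origin, whose center is on the normal at the height
    displayed. *)
Lemma normal_center (R : realType) (S : set (R * R)) (x y : R) :
  closed S -> center_closed S -> S (0, 0) -> tangent_to_x_axis S ->
  S (x, y) -> y != 0 -> S (0, (x ^+ 2 + y ^+ 2) / (2 * y)).
Proof.
move=> clS cS S0 tS Sp y0.
have /choice[f hf] (n : nat) : exists at_ : R * R,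
    [/\ at_.1 != 0, `|at_.1| < n.+1%:R^-1, `|at_.2| < n.+1%:R^-1 &
        S (at_.1, at_.1 * at_.2)].
  by have [|a [t []]] := tS n.+1%:R^-1; [rewrite invr_gt0|exists (a, t)].
pose a n := (f n).1; pose t n := (f n).2.
have cvg0 (g : nat -> R) : (forall n, `|g n| < n.+1%:R^-1) -> g @ \oo --> 0.
  move=> hg; apply/cvgr0Pnorm_lt => e e0; have [N hN] := inv_succ_lt R e e0.
  by exists N => // n /= Nn; exact: lt_trans (hg n) (hN n Nn).
have ca : a @ \oo --> 0 by apply: cvg0 => n; case: (hf n).
have ct : t @ \oo --> 0 by apply: cvg0 => n; case: (hf n).
pose q := x ^+ 2 + y ^+ 2.
(* By Cramer's rule the circumcenter of (0, 0), (a, a t), (x, y) is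
   (s y - q t, q - s x) / (2 D). *)
pose D n := y - t n * x; pose s n := a n * (1 + t n * t n).
have cD : D @ \oo --> y.
  rewrite -[X in _ --> X]subr0 -[X in _ - X](mul0r x).
  by apply: cvgB; [exact: cvg_cst|apply: cvgM => //; exact: cvg_cst].
have cs : s @ \oo --> 0.
  rewrite -[X in _ --> X](mul0r (1 + 0 * 0)).
  by apply: cvgM => //; apply: cvgD; [exact: cvg_cst|exact: cvgM].
have cDV : (fun n => (2 * D n)^-1) @ \oo --> (2 * y)^-1.
  apply: cvgV; first by rewrite mulf_neq0.
  by apply: cvgM => //; exact: cvg_cst.
have c1 : (fun n => (s n * y - q * t n) * (2 * D n)^-1) @ \oo --> 0.
  rewrite -[X in _ --> X](_ : (0 * y - q * 0) * (2 * y)^-1 = 0); last first.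
    by rewrite mul0r mulr0 subrr mul0r.
  apply: cvgM => //; apply: cvgB; apply: cvgM => //; exact: cvg_cst.
have c2 : (fun n => (q - s n * x) * (2 * D n)^-1) @ \oo --> q / (2 * y).
  rewrite -[X in _ --> X](_ : (q - 0 * x) * (2 * y)^-1 = _); last first.
    by rewrite mul0r subr0.
  apply: cvgM => //; apply: cvgB; first exact: cvg_cst.
  by apply: cvgM => //; exact: cvg_cst.
have cc : (fun n => ((s n * y - q * t n) * (2 * D n)^-1,
    (q - s n * x) * (2 * D n)^-1)) @ \oo --> ((0, q / (2 * y)) : R * R).
  exact: (cvg_pair c1 c2).
apply: (closed_cvg _ clS _ _ cc).
have nD : \forall n \near \oo, D n != 0 by exact: cvgr_neq0 cD y0.
near=> n.
have Dn : D n != 0 by near: n.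
have [a0 _ _ San] := hf n; rewrite -/(a n) -/(t n) in a0 San.
rewrite /D in Dn.
apply: (cS _ _ _ _ S0 San Sp); rewrite /area2 /sqdist /s /D /q /=; [|by field..].
rewrite !subr0 (_ : _ - _ = a n * (y - t n * x)) ?mulf_neq0 //; ring.
Unshelve. all: by end_near.
Qed.

(** Centers of the limit circles through a point of S tangent at the origin to
    the x-axis, and to the y-axis, belong to S. *)
Definition bitangent {R : realType} (S : set (R * R)) : Prop :=
  [/\ closed S, center_closed S, S (0, 0),
      (forall x y, S (x, y) -> y != 0 -> S (0, (x ^+ 2 + y ^+ 2) / (2 * y))) &
      (forall x y, S (x, y) -> x != 0 -> S ((x ^+ 2 + y ^+ 2) / (2 * x), 0))].

Lemma quarter_turn (R : realType) (x y : R) :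
  frame (0, 0) (0, 1) (x, y) = (- y, x).
Proof. by rewrite /frame /= !mulr0 !mulr1 !add0r addr0. Qed.

Lemma bitangent_quarter_turn (R : realType) (S : set (R * R)) :
  bitangent S -> bitangent (frame (0, 0) (0, 1) @^-1` S).
Proof.
move=> [clS cS S0 hN hT]; split.
- exact: closed_frame.
- by apply: center_closed_frame => //; rewrite pair_neq0r ?oner_eq0.
- by rewrite /preimage /= quarter_turn oppr0.
- move=> x y; rewrite /preimage /= !quarter_turn => Sp y0.
  have := hT _ _ Sp; rewrite oppr_eq0 => /(_ y0).
  by rewrite sqrrN mulrN invrN mulrN addrC.
- move=> x y; rewrite /preimage /= !quarter_turn => Sp x0.
  by have := hN _ _ Sp x0; rewrite sqrrN addrC oppr0.
Qed.

(** For a point of the normal at height z, the limit circle has that point and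
    the origin as ends of a diameter, so its center is at height z / 2.  The
    points (0, z / 2 ^ k) of S then accumulate at the origin
    along the y-axis, and the argument of [normal_center] applies to that axis
    as well. *)
Lemma bitangent_of_tangent (R : realType) (S : set (R * R)) (x y : R) :
  closed S -> center_closed S -> S (0, 0) -> tangent_to_x_axis S ->
  S (x, y) -> y != 0 -> bitangent S.
Proof.
move=> clS cS S0 tS Sp y0.
have hN x' y' := normal_center R S x' y' clS cS S0 tS.
split => // x' y' Sp' x0'.
pose z := (x ^+ 2 + y ^+ 2) / (2 * y).
have z0 : z != 0.
  rewrite mulf_neq0 ?invr_eq0 ?mulf_neq0 // gt_eqF // ltr_wpDl ?sqr_ge0 //.
  by rewrite lt_def sqr_ge0 sqrf_eq0 y0.
have Sz (k : nat) : S (0, z * (1 / 2) ^+ k).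
  elim: k => [|k IH]; first by rewrite expr0 mulr1; exact: hN.
  have := hN _ _ IH; rewrite mulf_neq0 ?expf_neq0 // => /(_ isT).
  suff -> : (0 ^+ 2 + (z * (1 / 2) ^+ k) ^+ 2) / (2 * (z * (1 / 2) ^+ k)) =
            z * (1 / 2) ^+ k.+1 by [].
  have w0 : z * (1 / 2) ^+ k != 0 by rewrite mulf_neq0 ?expf_neq0.
  rewrite [_ ^+ k.+1]exprSr [RHS]mulrA; move: (z * _) w0 => w w0.
  by field.
have : (frame (0, 0) (0, 1) @^-1` S) (0, ((y' ^+ 2 + (- x') ^+ 2)) / (2 * - x')).
  apply: normal_center.
  - exact: closed_frame.
  - by apply: center_closed_frame => //; rewrite pair_neq0r ?oner_eq0.
  - by rewrite /preimage /= quarter_turn oppr0.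
  - move=> e e0.
    have zn : 0 < `|z| by rewrite normr_gt0.
    have [k hk] := @expr_small R (1 / 2) (e / `|z|) ltac:(lra) ltac:(by rewrite divr_gt0).
    exists (z * (1 / 2) ^+ k), 0; split.
    + by rewrite mulf_neq0 ?expf_neq0.
    + by rewrite normrM [`|_ ^+ k|]ger0_norm ?exprn_ge0 // mulrC -ltr_pdivlMr.
    + by rewrite normr0.
    + by rewrite /preimage /= mulr0 quarter_turn oppr0.
  - by rewrite /preimage /= quarter_turn opprK.
  - by rewrite oppr_eq0.
by rewrite /preimage /= quarter_turn sqrrN mulrN invrN mulrN opprK addrC.
Qed.

(** * From two axes to the plane *)

Lemma bitangent_halve_y (R : realType) (S : set (R * R)) (y : R) (k : nat) :
  bitangent S -> S (0, y) -> y != 0 -> S (0, y / 2 ^+ k).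
Proof.
move=> [_ _ _ hN _] Sy y0; elim: k => [|k IH]; first by rewrite expr0 divr1.
have w0 : y / 2 ^+ k != 0 by rewrite mulf_neq0 ?invr_eq0 ?expf_neq0.
have -> : y / 2 ^+ k.+1 = y / 2 ^+ k / 2 by rewrite exprSr invfM mulrA.
have := hN _ _ IH w0; move: (y / _) w0 => w w0.
by rewrite (_ : (_ + _) / _ = w / 2) //; field.
Qed.

Lemma bitangent_halve_x (R : realType) (S : set (R * R)) (x : R) (k : nat) :
  bitangent S -> S (x, 0) -> x != 0 -> S (x / 2 ^+ k, 0).
Proof.
move=> bS Sx x0.
have := @bitangent_halve_y R _ x k
  (bitangent_quarter_turn R _ (bitangent_quarter_turn R _ (bitangent_quarter_turn R _ bS))).
have turn3 z : frame (0, 0) (0, 1) (frame (0, 0) (0, 1) (frame (0, 0) (0, 1) z)) =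
    (z.2, - z.1) :> R * R by rewrite /frame /=; congr pair; ring.
by rewrite /preimage /= !turn3 /= oppr0; apply.
Qed.

(** The midpoint (x / 2, y / 2) is the circumcenter of the right triangle
    (0, 0), (x, 0), (0, y); the limit circle through it tangent to the x-axis at
    the origin has the center displayed. *)
Lemma bitangent_center_y (R : realType) (S : set (R * R)) (x y : R) :
  bitangent S -> S (x, 0) -> S (0, y) -> x != 0 -> y != 0 ->
  S (0, y / 4 + x ^+ 2 / (4 * y)).
Proof.
move=> [_ cS S0 hN _] Sx Sy x0 y0.
have Sm : S (x / 2, y / 2).
  apply: (cS _ _ _ _ S0 Sx Sy); rewrite /area2 /sqdist /=; [|by field..].
  by rewrite !subr0 mul0r subr0 mulf_neq0.
have := hN _ _ Sm; rewrite mulf_neq0 ?invr_eq0 // => /(_ isT).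
by rewrite (_ : (_ + _) / _ = y / 4 + x ^+ 2 / (4 * y)) //; field.
Qed.

(** Apply [bitangent_center_y] to x / 2 ^ j and y / 2 ^ k with k = 2 j + m: the
    term in y tends to 0 as j grows while the term in x ^ 2 / y keeps the
    coefficient 2 ^ m. *)
Lemma bitangent_inverse_y (R : realType) (S : set (R * R)) (x y : R) (m : nat) :
  bitangent S -> S (x, 0) -> S (0, y) -> x != 0 -> y != 0 ->
  S (0, 2 ^+ m * x ^+ 2 / (4 * y)).
Proof.
move=> bS Sx Sy x0 y0; have [clS _ _ _ _] := bS.
apply: closed_approx => // e e0.
have yn : 0 < `|y| by rewrite normr_gt0.
have [j hj] := @expr_small R (1 / 2) (e / `|y|) ltac:(lra) ltac:(by rewrite divr_gt0).
have j0 : (2 : R) ^+ j != 0 by rewrite expf_neq0.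
have m0 : (2 : R) ^+ m != 0 by rewrite expf_neq0.
exists (0, y / 2 ^+ (j + j + m) / 4 +
  (x / 2 ^+ j) ^+ 2 / (4 * (y / 2 ^+ (j + j + m)))).
  apply: bitangent_center_y => //; first exact: bitangent_halve_x.
  - exact: bitangent_halve_y.
  - by rewrite mulf_neq0 ?invr_eq0.
  - by rewrite mulf_neq0 ?invr_eq0 ?expf_neq0.
rewrite /= subrr normr0; split=> //.
have -> : y / 2 ^+ (j + j + m) / 4 +
  (x / 2 ^+ j) ^+ 2 / (4 * (y / 2 ^+ (j + j + m))) - 2 ^+ m * x ^+ 2 / (4 * y)
  = y * (1 / 2) ^+ j * ((1 / 2) ^+ (j + m) / 4).
  rewrite !exprD !expr_div_n !expr1n.
  move: (2 ^+ j) (2 ^+ m) j0 m0 => a b a0 b0; field.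
  by rewrite b0 a0 y0.
have [p0 p1] : 0 <= (1 / 2 : R) ^+ (j + m) /\ (1 / 2 : R) ^+ (j + m) <= 1.
  by split; [rewrite exprn_ge0|rewrite exprn_ile1]; lra.
rewrite 2!normrM [`|_ ^+ j|]ger0_norm ?exprn_ge0 // [`|_ / 4|]ger0_norm ?divr_ge0 //.
apply: le_lt_trans (_ : `|y| * (1 / 2) ^+ j * 1 < e).
  by rewrite ler_wpM2l ?mulr_ge0 ?exprn_ge0 //; lra.
by rewrite mulr1 mulrC -ltr_pdivlMr.
Qed.

(** The map y |-> x ^ 2 / (4 y) is an involution, so applying
    [bitangent_inverse_y] twice, with the factors 1 and 2, doubles y. *)
Lemma bitangent_double_y (R : realType) (S : set (R * R)) (x y : R) :
  bitangent S -> S (x, 0) -> S (0, y) -> x != 0 -> y != 0 -> S (0, 2 * y).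
Proof.
move=> bS Sx Sy x0 y0.
have := bitangent_inverse_y R S x y 0 bS Sx Sy x0 y0; rewrite expr0 mul1r => Sz.
have z0 : x ^+ 2 / (4 * y) != 0.
  by rewrite mulf_neq0 ?invr_eq0 ?mulf_neq0 ?sqrf_eq0.
have := bitangent_inverse_y R S _ _ 1 bS Sx Sz x0 z0.
by rewrite (_ : _ / _ = 2 * y) //; field; rewrite y0 x0.
Qed.

(** The height of [bitangent_center_y], doubled twice. *)
Lemma bitangent_climb_y (R : realType) (S : set (R * R)) (x y : R) :
  bitangent S -> S (x, 0) -> S (0, y) -> x != 0 -> 0 < y ->
  S (0, y + x ^+ 2 / y).
Proof.
move=> bS Sx Sy x0 y0.
have Sg := bitangent_center_y R S x y bS Sx Sy x0 (lt0r_neq0 y0).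
have g0 : y / 4 + x ^+ 2 / (4 * y) != 0.
  rewrite gt_eqF // ltr_wpDr ?divr_ge0 ?sqr_ge0 ?mulr_ge0 ?(ltW y0) //.
  by rewrite divr_gt0.
have Sd := bitangent_double_y R S x _ bS Sx Sg x0 g0.
have d0 : 2 * (y / 4 + x ^+ 2 / (4 * y)) != 0 by rewrite mulf_neq0.
have := bitangent_double_y R S x _ bS Sx Sd x0 d0.
rewrite (_ : 2 * _ = y + x ^+ 2 / y) //; field.
by rewrite lt0r_neq0.
Qed.

(** With x replaced by x / 2 ^ j, [bitangent_climb_y] moves up the y-axis by
    steps that are as small as desired but, below the height t, at least
    x ^ 2 / t.  Starting under t, such a walk comes within e of t, and S is
    closed. *)
Lemma bitangent_half_axis (R : realType) (S : set (R * R)) (x0 y0 t : R) :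
  bitangent S -> S (x0, 0) -> S (0, y0) -> x0 != 0 -> 0 < y0 -> 0 < t ->
  S (0, t).
Proof.
move=> bS Sx0 Sy0 x00 y00 t0; have [clS _ _ _ _] := bS.
apply: closed_approx => // e e0 /=.
have pow2 (k : nat) : (1 / 2) ^+ k = (2 ^+ k)^-1 :> R.
  by rewrite expr_div_n expr1n div1r.
have [k hk] := @expr_small R (1 / 2) (t / y0) ltac:(lra) ltac:(by rewrite divr_gt0).
(* The walk starts at y1, and x ^ 2 < e * y1 makes its steps shorter than e. *)
pose y1 := y0 / 2 ^+ k.
have y1t : y1 < t by rewrite /y1 -pow2 mulrC -ltr_pdivlMr.
have y10 : 0 < y1 by rewrite divr_gt0 ?exprn_gt0.
have Sy1 : S (0, y1) by apply: bitangent_halve_y; rewrite ?gt_eqF.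
have x2 : 0 < x0 ^+ 2 by rewrite lt_def sqr_ge0 sqrf_eq0 x00.
have [j hj] := @expr_small R (1 / 4) (e * y1 / x0 ^+ 2) ltac:(lra)
  ltac:(exact: divr_gt0 (mulr_gt0 e0 y10) x2).
pose x := x0 / 2 ^+ j.
have xe : x ^+ 2 < e * y1.
  have -> : x ^+ 2 = (1 / 4) ^+ j * x0 ^+ 2.
    have -> : 1 / 4 = (1 / 2) ^+ 2 :> R by field.
    by rewrite exprAC pow2 /x exprMn mulrC.
  by rewrite -ltr_pdivlMr.
have xn0 : x != 0 by rewrite mulf_neq0 ?invr_eq0 ?expf_neq0.
have Sx : S (x, 0) by apply: bitangent_halve_x.
have {hj}x20 : 0 < x ^+ 2 by rewrite lt_def sqr_ge0 sqrf_eq0 xn0.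
have walk (n : nat) : (exists2 y, S (0, y) & t - e < y <= t) \/
    (exists2 y, S (0, y) & y1 + n%:R * (x ^+ 2 / t) <= y <= t).
  elim: n => [|n [IH|[y Sy /andP[h1 h2]]]]; [|by left|].
    by right; exists y1; rewrite // mul0r addr0 lexx ltW.
  have [le|lt] := leP y (t - e); last by left; exists y; rewrite // lt h2.
  have yy1 : y1 <= y.
    by apply: le_trans h1; rewrite lerDl mulr_ge0 // divr_ge0 // ltW.
  have yp : 0 < y := lt_le_trans y10 yy1.
  right; exists (y + x ^+ 2 / y); first exact: bitangent_climb_y.
  apply/andP; split.
    rewrite -natr1 mulrDl mul1r addrA lerD //.
    by rewrite ler_wpM2l ?sqr_ge0 // lef_pV2 ?posrE.
  have : x ^+ 2 / y <= e; last by lra.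
  by rewrite ler_pdivrMr // (le_trans (ltW xe)) // ler_wpM2l // ltW.
have d0 : 0 < x ^+ 2 / t by rewrite divr_gt0.
have [[y Sy /andP[h1 h2]]|[y Sy /andP[h1 h2]]] := walk (Num.bound (t / (x ^+ 2 / t))).
  exists (0, y) => //=; rewrite subrr normr0; split => //.
  by rewrite ltr_norml; lra.
have := archi_boundP (ltW (divr_gt0 t0 d0)).
by rewrite ltr_pdivrMr //; lra.
Qed.

(** A circle centered at c meets the y-axis in points placed symmetrically about
    height c.2; they are in S as soon as both heights are positive.  It remains
    to make the circle pass through a point (x, 0) of S, and a small
    x = x0 / 2 ^ j qualifies. *)
Lemma bitangent_quadrant (R : realType) (S : set (R * R)) (x0 y0 : R) (c : R * R) :
  bitangent S -> S (x0, 0) -> S (0, y0) -> 0 < x0 -> 0 < y0 ->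
  0 < c.1 -> 0 < c.2 -> S c.
Proof.
move: c => [c1 c2] /= bS Sx0 Sy0 x00 y00 c10 c20.
have ne0 := lt0r_neq0 x00; have [_ cS _ _ _] := bS.
(* h2 is the square of the half chord that the circle about c through (x, 0)
   cuts on the y-axis.  The two bounds in m give 0 < h2 < c2 ^ 2: the second
   one yields 2 x c1 < c2 ^ 2, the first x ^ 2 < 2 x c1. *)
pose m := Num.min (2 * c1) (c2 ^+ 2 / (2 * c1)).
have m0 : 0 < m by rewrite lt_min mulr_gt0 //= divr_gt0 ?exprn_gt0 ?mulr_gt0.
have [j hj] := @expr_small R (1 / 2) (m / x0) ltac:(lra) ltac:(by rewrite divr_gt0).
pose x := x0 / 2 ^+ j.
have xm : x < m.
  by move: hj; rewrite expr_div_n expr1n div1r ltr_pdivlMr // mulrC.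
have xp : 0 < x by rewrite divr_gt0 ?exprn_gt0.
have Sx : S (x, 0) by apply: bitangent_halve_x.
move: xm; rewrite lt_min => /andP[x1].
rewrite ltr_pdivlMr ?mulr_gt0 // => xc.
pose h2 := x ^+ 2 - 2 * x * c1 + c2 ^+ 2.
have h2p : 0 < h2.
  have : 0 < x ^+ 2 by rewrite exprn_gt0.
  by rewrite /h2; lra.
have h2c : h2 < c2 ^+ 2.
  have : x * x < x * (2 * c1) by rewrite ltr_pM2l.
  by rewrite /h2 expr2; lra.
pose h := Num.sqrt h2.
have hh : h ^+ 2 = h2 by rewrite sqr_sqrtr // ltW.
have hp : 0 < h by rewrite sqrtr_gt0.
have hc : h < c2 by rewrite -(@ltr_pXn2r _ 2) ?nnegrE ?ltW // hh.
have Sa : S (0, c2 + h) by apply: bitangent_half_axis bS Sx0 Sy0 ne0 y00 _; lra.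
have Sb : S (0, c2 - h) by apply: bitangent_half_axis bS Sx0 Sy0 ne0 y00 _; lra.
apply: (cS _ _ _ _ Sa Sb Sx); rewrite /area2 /sqdist /=.
- rewrite (_ : _ - _ = 2 * h * x); first by rewrite !mulf_neq0 ?gt_eqF.
  by ring.
- by ring.
- rewrite (_ : _ + _ = c1 ^+ 2 + h ^+ 2); last by ring.
  by rewrite hh /h2; ring.
Qed.

(** Every point c is the center of a large circle, and three points of such a
    circle with direction well inside the quadrant are in the quadrant. *)
Lemma setT_of_quadrant (R : realType) (S : set (R * R)) :
  center_closed S -> (forall c, 0 < c.1 -> 0 < c.2 -> S c) -> S = setT.
Proof.
move=> cS hq; apply/seteqP; split=> // -[c1 c2] _.
pose r := `|c1| + `|c2| + 1.
have a1 := ler_norm (- c1); have a2 := ler_norm (- c2).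
rewrite !normrN in a1 a2.
have n1 := normr_ge0 c1; have n2 := normr_ge0 c2.
have S' (u v : R) : 1 <= u -> 1 <= v -> S (c1 + r * u, c2 + r * v).
  move=> u1 v1; have r0 : 0 <= r by rewrite /r; lra.
  have : r * 1 <= r * u by rewrite ler_wpM2l.
  have : r * 1 <= r * v by rewrite ler_wpM2l.
  by rewrite !mulr1 => h1 h2; apply: hq => /=; rewrite /r in h1 h2 *; lra.
have r0 : r != 0 by rewrite gt_eqF // /r; lra.
(* 39 ^ 2 + 52 ^ 2 = 52 ^ 2 + 39 ^ 2 = 25 ^ 2 + 60 ^ 2 = 65 ^ 2. *)
have Sa := S' 39 52 ltac:(lra) ltac:(lra).
have Sb := S' 52 39 ltac:(lra) ltac:(lra).
have Sc := S' 25 60 ltac:(lra) ltac:(lra).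
apply: (cS _ _ _ _ Sa Sb Sc); rewrite /area2 /sqdist /=; [|by ring..].
rewrite (_ : _ - _ = - (78 * r ^+ 2)); last by ring.
by rewrite oppr_eq0 mulf_neq0 ?expf_neq0.
Qed.

Lemma bitangent_setT (R : realType) (S : set (R * R)) (x y : R) :
  bitangent S -> S (x, 0) -> S (0, y) -> x != 0 -> y != 0 -> S = setT.
Proof.
have turn (T : set (R * R)) : frame (0, 0) (0, 1) @^-1` T = setT -> T = setT.
  by apply: preimage_frame_setT; rewrite pair_neq0r ?oner_eq0.
(* A quarter turn maps the signs (a, b) of the two coordinates to (b, - a), so
   the four cases reduce to the positive one in turn. *)
have pp (T : set (R * R)) a b : bitangent T -> T (a, 0) -> T (0, b) ->
    0 < a -> 0 < b -> T = setT.
  move=> bT Ta Tb a0 b0; have [_ cT _ _ _] := bT.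
  by apply: setT_of_quadrant => // c; apply: bitangent_quadrant bT Ta Tb a0 b0.
have np (T : set (R * R)) a b : bitangent T -> T (a, 0) -> T (0, b) ->
    a < 0 -> 0 < b -> T = setT.
  move=> /bitangent_quarter_turn bT Ta Tb a0 b0; apply: turn.
  by apply: (pp _ b (- a) bT); rewrite ?oppr_gt0 // /preimage /= quarter_turn ?oppr0 ?opprK.
have nn (T : set (R * R)) a b : bitangent T -> T (a, 0) -> T (0, b) ->
    a < 0 -> b < 0 -> T = setT.
  move=> /bitangent_quarter_turn bT Ta Tb a0 b0; apply: turn.
  by apply: (np _ b (- a) bT); rewrite ?oppr_gt0 // /preimage /= quarter_turn ?oppr0 ?opprK.
move=> bS Sx Sy; case: ltgtP => // x0 _; case: ltgtP => // y0 _.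
- exact: nn bS Sx Sy x0 y0.
- exact: np bS Sx Sy x0 y0.
- apply: turn; apply: (nn _ y (- x) (bitangent_quarter_turn R _ bS));
    by rewrite ?oppr_lt0 // /preimage /= quarter_turn ?oppr0 ?opprK.
- exact: pp bS Sx Sy x0 y0.
Qed.

(** The three vertices of a triangle do not all lie on the line through the
    origin in the direction u. *)
Lemma isosceles_off_axis (R : realType) (S : set (R * R)) (u : R * R) (h : R) :
  u != 0 -> h != 0 -> isosceles S h ->
  exists x y, y != 0 /\ S (frame (0, 0) u (x, y)).
Proof.
move=> u0 h0 [_ S1 Sh]; have n0 := lt0r_neq0 (sqnorm_gt0 _ _ u0).
pose n := u.1 ^+ 2 + u.2 ^+ 2.
have fr (a b : R) : frame (0, 0) u
    ((a * u.1 + b * u.2) / n, (b * u.1 - a * u.2) / n) = (a, b).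
  by rewrite /frame /n /=; congr pair; field.
have [u20|u20] := eqVneq u.2 0; last first.
  exists ((1 * u.1 + 0 * u.2) / n), ((0 * u.1 - 1 * u.2) / n); rewrite fr; split=> //.
  by rewrite mul0r add0r mul1r mulf_neq0 ?oppr_eq0 ?invr_eq0.
exists ((1 / 2 * u.1 + h / 2 * u.2) / n), ((h / 2 * u.1 - 1 / 2 * u.2) / n).
rewrite fr; split=> //; rewrite u20 mulr0 subr0 !mulf_neq0 ?invr_eq0 //.
by apply: contra_neq u0 => u10; rewrite [u]surjective_pairing u10 u20.
Qed.

Lemma isosceles_setT (R : realType) (S : set (R * R)) (y : R) :
  closed S -> center_closed S -> y != 0 -> isosceles S y -> S = setT.
Proof.
move=> clS cS y0 iso.
have [h [h0 {}iso h3]] := exists_contracting R S y cS y0 iso.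
have k0 := sqr_ge0 (center_ordinate h).
have [e e0|u u0 tu] := limit_direction R S.
  have [n hn] := @expr_small R ((1 + center_ordinate h ^+ 2) / 4) e ltac:(lra) e0.
  have [z Sz ez] := isosceles_spiral R S h n cS h0 iso.
  by exists z; rewrite // ez hn andbT exprn_gt0 //; lra.
have [x' [y' [y'0 S']]] := isosceles_off_axis R S u h u0 h0 iso.
apply: (preimage_frame_setT _ _ (0, 0) u u0).
have S0' : (frame (0, 0) u @^-1` S) (0, 0).
  by rewrite /preimage /frame /= !mul0r subr0 !addr0; case: iso.
have bS : bitangent (frame (0, 0) u @^-1` S).
  apply: bitangent_of_tangent S' y'0 => //; first exact: closed_frame.
  exact: center_closed_frame.
have [_ _ _ hN hT] := bS.
have pos (a b : R) : b != 0 -> (a ^+ 2 + b ^+ 2) / (2 * b) != 0.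
  move=> b0; rewrite mulf_neq0 ?invr_eq0 ?mulf_neq0 // gt_eqF //.
  by rewrite ltr_wpDl ?sqr_ge0 // lt_def sqr_ge0 sqrf_eq0 b0.
have [a [t [a0 _ _ Sa]]] := tu 1 ltr01.
apply: (bitangent_setT _ _ _ _ bS (hT _ _ Sa a0) (hN _ _ S' y'0)); last exact: pos.
by rewrite addrC; exact: pos.
Qed.

(** * Closed circle-center sets *)

Theorem theorem2 (R : realType) :
  (closed [set: R * R] /\ circle_center_set [set: R * R]) /\
  (forall S : set (R * R), circle_center_set S -> closed S -> S = [set: R * R]).
Proof.
split.
  split; first exact: closedT.
  split=> // -[_ [a [b [c [ab0 ->]]]] sub].
  have /= h0 := sub (0, 0) I; have /= h1 := sub (1, 0) I.
  by have /= h2 := sub (0, 1) I; apply: ab0; congr pair; lra.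
move=> S [/noncollinear_triple[p [q [r [Sp Sq Sr d0]]]] ccS] clS.
have cS := circle_centers_center_closed R S ccS.
have [c [v [h [v0 h0 iso]]]] := exists_isosceles R S p q r cS Sp Sq Sr d0.
apply: (preimage_frame_setT _ _ c v v0).
apply: isosceles_setT h0 iso; first exact: closed_frame.
exact: center_closed_frame.
Qed.
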